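(* Let $n\ge 1$ and let $\lambda=(\lambda_1\ge\lambda_2\ge\cdots\ge\lambda_n\ge 0)$ be a partition with at most $n$ parts. The number of distinct diagonal vectors $\mathrm{diag}(T)$ of standard $\lambda$-shifted Young tableaux $T$ is equal to the number of integer lattice points (points of $\mathbb{Z}^n$) of the polytope $$\mathbf{P}_\lambda:=\sum_{1\le i\le j\le n-1}\Delta_{[i,j]}+\lambda_1\Delta_{[1,n]}+\lambda_2\Delta_{[2,n]}+\cdots+\lambda_n\Delta_{\{n\}}\subset\mathbb{R}^n.$$
   Context: The shifted Young diagram of shape $\lambda$ is the set of boxes $D_\lambda=\{(i,j)\in\mathbb{Z}^2 : 1\le i\le n,\ i\le j\le n+\lambda_i\}$, where $(i,j)$ is the box in row $i$ and column $j$; $|D_\lambda|=\binom{n+1}{2}+\lambda_1+\cdots+\lambda_n$. A standard $\lambda$-shifted (Young) tableau is a bijection $T:D_\lambda\to\{1,\dots,|D_\lambda|\}$ that is increasing along rows and down columns, i.e. $T(i,j)<T(i,j+1)$ and $T(i,j)<T(i+1,j)$ whenever the boxes involved lie in $D_\lambda$. The diagonal vector of $T$ is $\mathrm{diag}(T)=(T(1,1),T(2,2),\dots,T(n,n))$. Let $e_1,\dots,e_n$ be the standard basis of $\mathbb{R}^n$. For $I\subseteq\{1,\dots,n\}$, $\Delta_I=\mathrm{Conv}\{e_i : i\in I\}$. Write $[i,j]=\{i,i+1,\dots,j\}$. Sums of polytopes are Minkowski sums, and $c\,\Delta_I=\{cx:x\in\Delta_I\}$ for $c\ge0$. *)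

(* Defs.v *)
From mathcomp Require Import all_boot all_order all_algebra.
From mathcomp Require Import mathcomp_extra boolp classical_sets functions.
From mathcomp Require Import cardinality reals convex.

Set Implicit Arguments.
Unset Strict Implicit.
Unset Printing Implicit Defensive.

Import Order.TTheory GRing.Theory Num.Theory.

Local Open Scope classical_set_scope.
Local Open Scope ring_scope.

(** Rows, columns and parts are numbered from 1, as in [lambda_1, ..., lambda_n];
    only the library's ordinals ['I_n] are numbered from 0, so that [k : 'I_n]
    stands for the index [k.+1]. *)

Definition is_partition (n : nat) (lam : n.-tuple nat) : Prop :=
  sorted geq lam.

Definition part (n : nat) (lam : n.-tuple nat) (i : nat) : nat :=
  nth 0%N lam i.-1.

Definition shifted_diagram (n : nat) (lam : n.-tuple nat) : set (nat * nat) :=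
  [set b | (1 <= b.1 <= n)%N /\ (b.1 <= b.2 <= n + part lam b.1)%N].

(** [|D_lam|] *)
Definition diagram_size (n : nat) (lam : n.-tuple nat) : nat :=
  ('C(n.+1, 2) + \sum_(1 <= i < n.+1) part lam i)%N.

(** The values of [T] outside the diagram are irrelevant. *)
Definition standard_tableau (n : nat) (lam : n.-tuple nat)
    (T : nat * nat -> nat) : Prop :=
  [/\ set_bij (shifted_diagram lam)
        [set m : nat | (1 <= m <= diagram_size lam)%N] T,
      (forall i j, shifted_diagram lam (i, j) ->
         shifted_diagram lam (i, j.+1) -> (T (i, j) < T (i, j.+1))%N)
    & (forall i j, shifted_diagram lam (i, j) ->
         shifted_diagram lam (i.+1, j) -> (T (i, j) < T (i.+1, j))%N)].

Definition diag_vector (n : nat) (T : nat * nat -> nat) : 'rV[nat]_n :=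
  \row_(k < n) T (k.+1, k.+1).

Definition diag_vectors (n : nat) (lam : n.-tuple nat) : set 'rV[nat]_n :=
  [set diag_vector n T | T in [set T | standard_tableau lam T]].

Definition conv_hull (R : realType) (n : nat) (A : set 'rV[R]_n) :
    set 'rV[R]_n :=
  smallest (@convex_set R 'rV[R]_n) A.

Definition minkowski (R : realType) (n : nat) (A B : set 'rV[R]_n) :
    set 'rV[R]_n :=
  [set x + y | x in A & y in B].

Definition dilate (R : realType) (n : nat) (c : R) (A : set 'rV[R]_n) :
    set 'rV[R]_n :=
  [set c *: x | x in A].

Definition simplex (R : realType) (n : nat) (I : set 'I_n) : set 'rV[R]_n :=
  conv_hull [set delta_mx 0 k | k in I].
Arguments simplex R {n} I.

(** [{i, ..., j}] as a set of 1-based indices, see the convention above. *)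
Definition index_itv (n i j : nat) : set 'I_n :=
  [set k : 'I_n | (i <= k.+1 <= j)%N].
Arguments index_itv n i j : clear implicits.

(** A sum of polytopes over an empty range is the origin. *)
Definition P_polytope (R : realType) (n : nat) (lam : n.-tuple nat) :
    set 'rV[R]_n :=
  minkowski
    (\big[@minkowski R n/[set 0]]_(1 <= i < n)
       \big[@minkowski R n/[set 0]]_(i <= j < n) simplex R (index_itv n i j))
    (\big[@minkowski R n/[set 0]]_(1 <= i < n.+1)
       dilate (part lam i)%:R (simplex R (index_itv n i n))).
Arguments P_polytope R {n} lam.

Definition lattice_points (R : realType) (n : nat) (A : set 'rV[R]_n) :
    set 'rV[R]_n :=
  [set x | A x /\ forall k : 'I_n, x 0 k \is a Num.int].

(* Main.v *)
Require Import Defs.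
From mathcomp Require Import all_boot all_order all_algebra.
From mathcomp Require Import boolp classical_sets functions cardinality.
From mathcomp Require Import reals interval_inference convex.
From mathcomp Require Import zify.

(** The diagonal of a tableau [T] cuts the values into [n] gaps, the [k]-th one
    lying between [T (k, k)] and [T (k.+1, k.+1)] (the last gap is unbounded).
    A box [(i, j)] with [i < j] is larger than [(i, i)] and, when [j <= n],
    smaller than [(j, j)]; hence its gap lies in the interval from [i] to
    [minn j.-1 n].  These intervals, one for each off-diagonal box, are exactly
    the index sets of the simplices whose sum is the polytope, counted with
    multiplicity.  Call [gap_labelling] a choice of a gap in the interval of each
    off-diagonal box, and [content] the vector counting how often each gap is
    chosen.  Both sides of the theorem are in bijection with the set
    [gap_contents] of all such vectors.

    Tableaux.  The diagonal entry [T (k, k)] is the number of boxes with value at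
    most [T (k, k)]: these are [k] diagonal boxes and the off-diagonal boxes of
    gap less than [k], so the diagonal vector is a function [diag_of_content] of
    the content; it is injective on contents, which all have the same sum.
    Conversely, every content comes from a tableau.  Exchanging the labels of two
    adjacent boxes in the wrong order respects the intervals and increases the
    sum of [f b * (b.1 + b.2)], so finitely many exchanges lead to a labelling
    with the same content that is monotone along rows and columns
    ([monotone_rearrangement]).  Reading the boxes gap by gap, each
    gap starting with its diagonal box, then gives a standard tableau
    ([reading_tableau_standard]).

    Lattice points.  A labelling picks a vertex of each simplex, so contents are
    lattice points of the polytope ([gap_content_polytope]).  Conversely a
    lattice point is the vector of column sums of a nonnegative matrix with one
    row of sum [1], supported in the right interval, for each off-diagonal box.
    As its column sums are integers, the matrix can be replaced by a 0-1 matrix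
    that has the same column sums and vanishes wherever the first one does
    ([integral_transport], by Hall's marriage theorem); that matrix is a labelling
    ([polytope_gap_content]). *)

Set Implicit Arguments.
Unset Strict Implicit.
Unset Printing Implicit Defensive.

Import Order.TTheory GRing.Theory Num.Theory.

(** * Integral transportation *)

Lemma sum_finset_modular (K : finType) (x : K -> nat) (U V : {set K}) :
  (\sum_(k in U) x k + \sum_(k in V) x k =
   \sum_(k in U :|: V) x k + \sum_(k in U :&: V) x k)%N.
Proof.
rewrite (big_setID V (A := U)) (big_setID V (A := U :|: V)) /=.
rewrite [(_ :|: _) :&: _]finset.setIC finset.setKU.
by rewrite finset.setDUl finset.setDv finset.setU0; lia.
Qed.

Lemma leq_sum_subset (K : finType) (x : K -> nat) (U V : {set K}) :
  U \subset V -> (\sum_(k in U) x k <= \sum_(k in V) x k)%N.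
Proof.
by move=> /finset.setIidPr UV; rewrite [leqRHS](big_setID U) /= UV leq_addr.
Qed.

(** Hall's marriage theorem in which [k] may be chosen by up to [x k] elements,
    after Rado: in a family that satisfies Hall's condition and is minimal, each
    [A b] is a singleton.  Otherwise let [u], [v] be distinct in [A b]; deleting
    either one breaks the condition at some sets [b |: S] and [b |: T], and
    adding up the two violations contradicts the condition at [b |: (S :|: T)]
    and [S :&: T], by modularity of the sum of [x]. *)
Lemma hall_capacities (B K : finType) (x : K -> nat) (A : B -> {set K}) :
  (forall S : {set B},
     #|S| <= \sum_(k in \bigcup_(b in S) A b) x k)%N ->
  exists f : B -> K, (forall b, f b \in A b) /\
    forall k, (#|[set b | f b == k]%SET| <= x k)%N.
Proof.
have [m] := ubnP (\sum_b #|A b|)%N; elim: m A => // m IHm A ltAm hallA.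
have A_gt0 b : (0 < #|A b|)%N.
  have := hallA [set b]%SET; rewrite cards1 big_set1.
  case: (set_0Vmem (A b)) => [->|[k kA] _]; first by rewrite big_set0.
  by apply/card_gt0P; exists k.
have [/existsP[b /card_gt1P[u [v [uA vA neq_uv]]]]|] :=
  boolP [exists b, 1 < #|A b|]%N; last first.
  rewrite negb_exists => /forallP A_le1.
  have /fin_all_exists[f fA] b : exists k, A b = [set k]%SET.
    by apply/cards1P; rewrite eqn_leq A_gt0 leqNgt A_le1.
  exists f; split=> [b|k]; first by rewrite fA set11.
  apply: leq_trans (hallA _) _; rewrite -[leqRHS](big_set1 addn k x).
  apply/leq_sum_subset/bigcupsP => b; rewrite inE => /eqP <-.
  by rewrite fA.
pose A' z c := if c == b then A b :\ z else A c.
have [/existsP[z /andP[zA /forallP hallz]]|] := boolP [exists z in A b,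
    [forall S : {set B}, #|S| <= \sum_(k in \bigcup_(c in S) A' z c) x k]%N].
  have subA' c : A' z c \subset A c.
    by rewrite /A'; case: eqP => [->|//]; apply: subsetDl.
  have [|f [fA fx]] := IHm (A' z) _ hallz.
    rewrite ltnS in ltAm; apply: leq_trans ltAm.
    rewrite (bigD1 b) //= [leqRHS](bigD1 b) //=.
    rewrite -addSn leq_add //; last by apply: leq_sum => c _; apply/subset_leq_card.
    by rewrite /A' eqxx (cardsD1 z (A b)) zA.
  by exists f; split=> [c|//]; apply: (fintype.subsetP (subA' c)); apply: fA.
rewrite negb_exists => /forallP viol.
have getS z : z \in A b -> exists S : {set B}, b \notin S /\
   (\sum_(k in \bigcup_(c in S) A c :|: (A b :\ z)) x k <= #|S|)%N.
  move=> zA; have := viol z; rewrite zA negb_forall => /existsP[S].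
  rewrite -ltnNge => ltS; have bS : b \in S.
    apply: contraLR ltS => bS; rewrite -leqNgt; apply: leq_trans (hallA S) _.
    apply/leq_sum_subset/bigcupsP => c cS.
    apply: fintype.subset_trans _ (finset.bigcup_sup c cS).
    by rewrite /A'; case: eqP cS bS => [->->|].
  exists (S :\ b); rewrite setD11; split=> //.
  rewrite (cardsD1 b) bS ltnS in ltS; apply: leq_trans ltS.
  apply/leq_sum_subset; rewrite finset.subUset; apply/andP; split.
    apply/bigcupsP => c; rewrite !inE => /andP[cb cS].
    by apply: fintype.subset_trans _ (finset.bigcup_sup c cS); rewrite /A' (negPf cb).
  by apply: fintype.subset_trans _ (finset.bigcup_sup b bS); rewrite /A' eqxx.
have [S [bS leS]] := getS u uA; have [T [bT leT]] := getS v vA.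
set U := _ :|: _ in leS; set V := _ :|: _ in leT.
have := sum_finset_modular x U V.
have leU : (#|b |: (S :|: T)| <= \sum_(k in U :|: V) x k)%N.
  apply: leq_trans (hallA _) _; apply/leq_sum_subset/bigcupsP => c.
  rewrite !inE => /or3P[/eqP->|cS|cT]; apply/fintype.subsetP => k kc; rewrite !inE.
  - rewrite kc !andbT; case: (eqVneq k u) => [->|]; last by rewrite !orbT.
    by rewrite neq_uv !orbT.
  - by rewrite (fintype.subsetP (finset.bigcup_sup c cS)) ?orbT.
  - by rewrite (fintype.subsetP (finset.bigcup_sup c cT)) ?orbT.
have leI : (#|S :&: T| <= \sum_(k in U :&: V) x k)%N.
  apply: leq_trans (hallA _) _; apply/leq_sum_subset/bigcupsP => c.
  rewrite inE => /andP[cS cT]; apply/fintype.subsetP => k kc; rewrite !inE.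
  rewrite (fintype.subsetP (finset.bigcup_sup c cS)) //.
  by rewrite (fintype.subsetP (finset.bigcup_sup c cT)).
rewrite cardsU1 inE (negPf bS) (negPf bT) /= in leU.
have := cardsUI S T; lia.
Qed.

(** For a set [S] of rows with supports in [U], the mass [#|S|] of these rows lies
    in the columns of [U], so it is at most the sum of [x] over [U]: this is
    Hall's condition for the supports.  The bounds [x k] are then attained, since
    both sides sum to the number of rows. *)
Lemma integral_transport (R : realType) (B K : finType) (w : B -> K -> R)
    (x : K -> nat) :
  (forall b k, 0 <= w b k)%R -> (forall b, \sum_k w b k = 1)%R ->
  (forall k, \sum_b w b k = (x k)%:R)%R ->
  exists f : B -> K, (forall b, w b (f b) != 0%R) /\
    forall k, #|[set b | f b == k]%SET| = x k.
Proof.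
move=> w_ge0 w_row w_col.
pose A b := [set k | w b k != 0%R]%SET.
have [S|f [fA fx]] := @hall_capacities B K x A.
  rewrite -(ler_nat R) natr_sum.
  rewrite -[in leRHS](eq_bigr _ (fun k _ => w_col k)) exchange_big /=.
  rewrite -sum1_card natr_sum [leRHS](bigID (mem S)) /=.
  rewrite ler_wpDr ?sumr_ge0 // => [b _|]; first exact: sumr_ge0.
  apply: ler_sum => b bS; rewrite -(w_row b) (bigID (mem (\bigcup_(b in S) A b))) /=.
  rewrite [X in (_ + X)%R]big1 ?addr0 ?mulr1n // => k; apply: contraNeq => wk.
  by apply/finset.bigcupP; exists b; rewrite ?inE.
exists f; split=> [b|k]; first by have := fA b; rewrite inE.
have tot : \sum_k #|[set b | f b == k]%SET| = \sum_k x k.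
  have -> : \sum_k #|[set b | f b == k]%SET| = #|B|.
    rewrite -sum1_card (partition_big f predT) //=; apply: eq_bigr => k' _.
    by rewrite -sum1_card; apply: eq_bigl => b; rewrite inE.
  apply/eqP; rewrite -(eqr_nat R) natr_sum -(eq_bigr _ (fun k _ => w_col k)).
  by rewrite exchange_big /= (eq_bigr _ (fun b _ => w_row b)) sumr_const.
have := leqif_sum (fun k (_ : true) => conj (fx k) erefl).
move=> [_]; rewrite tot eqxx => /esym/forall_inP/(_ k isT)/eqP //.
Qed.

Lemma integral_transport_seq (R : realType) (T : eqType) (K : finType) (k0 : K)
    (s : seq T) (w : T -> K -> R) (x : K -> nat) :
  uniq s ->
  (forall b k, b \in s -> 0 <= w b k)%R ->
  (forall b, b \in s -> \sum_k w b k = 1)%R ->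
  (forall k, \sum_(b <- s) w b k = (x k)%:R)%R ->
  exists f : T -> K, (forall b, b \in s -> w b (f b) != 0%R) /\
    forall k, count (fun b => f b == k) s = x k.
Proof.
move=> us w_ge0 w_row w_col.
pose t := tnth (in_tuple s).
have ts i : t i \in s by apply: (mem_tnth i (in_tuple s)).
have [i k|i|k|f [fw fx]] := @integral_transport R 'I_(size s) K (fun i => w (t i)) x.
- exact: w_ge0.
- exact: w_row.
- by rewrite -w_col [RHS]big_tnth.
pose g b := nth k0 [seq f i | i <- enum 'I_(size s)] (index b s).
have gt i : g (t i) = f i.
  rewrite /g /t (tnth_nth (t i)) /= index_uniq // (nth_map i) ?size_enum_ord //.
  by rewrite nth_ord_enum.
exists g; split=> [b /seq_tnthP[i ->]|k]; first by rewrite [g _]gt.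
rewrite -fx -sum1_count big_tnth -sum1_card; apply: eq_bigl => i.
by rewrite inE -[g _]/(g (t i)) gt.
Qed.

(** * Boxes and gap labellings *)

Definition diag_boxes (n : nat) : seq (nat * nat) :=
  [seq (i, i) | i <- index_iota 1 n.+1].

Definition offdiag_boxes (n : nat) (lam : n.-tuple nat) : seq (nat * nat) :=
  [seq (i, j) | i <- index_iota 1 n.+1,
                j <- index_iota i.+1 (n + part lam i).+1].

(** Gaps are numbered from 1, like the diagonal boxes that open them. *)
Definition gap_labelling (n : nat) (lam : n.-tuple nat)
    (f : nat * nat -> nat) : Prop :=
  forall b : nat * nat, b \in offdiag_boxes lam -> (b.1 <= f b <= minn b.2.-1 n)%N.

Definition content (n : nat) (lam : n.-tuple nat) (f : nat * nat -> nat) :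
    'rV[nat]_n :=
  \row_(k < n) count (fun b => f b == k.+1) (offdiag_boxes lam).

Definition gap_contents (n : nat) (lam : n.-tuple nat) : set 'rV[nat]_n :=
  [set content lam f | f in [set f | gap_labelling lam f]]%classic.

(** The coordinate [k] stands for the diagonal box [(k.+1, k.+1)], preceded by
    [k] diagonal boxes and by the boxes of the gaps numbered [1] to [k]. *)
Definition diag_of_content (n : nat) (c : 'rV[nat]_n) : 'rV[nat]_n :=
  \row_(k < n) (k.+1 + \sum_(m < n | (m < k)%N) c ord0 m)%N.

Lemma mem_diag_boxes n (b : nat * nat) :
  (b \in diag_boxes n) = (1 <= b.1 <= n)%N && (b.1 == b.2).
Proof.
case: b => i j /=; apply/mapP/andP => [[m]|[ij /eqP <-]].
  by rewrite mem_index_iota => mn [-> ->]; split; lia.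
by exists i; rewrite ?mem_index_iota //; lia.
Qed.

Lemma mem_offdiag_boxes n (lam : n.-tuple nat) (b : nat * nat) :
  (b \in offdiag_boxes lam) =
  (1 <= b.1 <= n)%N && (b.1 < b.2 <= n + part lam b.1)%N.
Proof.
case: b => i j /=; apply/allpairsPdep/andP => [[i' [j' [+ + [-> ->]]]]|[iP jP]].
  by rewrite !mem_index_iota => ? ?; split; lia.
by exists i, j; rewrite !mem_index_iota; split=> //; lia.
Qed.

Lemma shifted_diagramE n (lam : n.-tuple nat) b :
  shifted_diagram lam b <-> b \in diag_boxes n ++ offdiag_boxes lam.
Proof.
case: b => i j; rewrite mem_cat mem_diag_boxes mem_offdiag_boxes /shifted_diagram /=.
split=> [[]|]; last by move=> /orP[] /andP[? ?]; split; lia.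
by case: (eqVneq i j) => //=; lia.
Qed.

Lemma uniq_offdiag_boxes n (lam : n.-tuple nat) : uniq (offdiag_boxes lam).
Proof.
apply: allpairs_uniq_dep => [|i _|]; rewrite ?iota_uniq //.
by move=> [i j] [i' j'] _ _ /= [-> ->].
Qed.

Lemma uniq_boxes n (lam : n.-tuple nat) :
  uniq (diag_boxes n ++ offdiag_boxes lam).
Proof.
rewrite cat_uniq uniq_offdiag_boxes andbT map_inj_uniq ?iota_uniq /=.
  apply/hasPn => b; rewrite mem_offdiag_boxes mem_diag_boxes; lia.
by move=> i j [].
Qed.

(** The two families of simplices in the polytope: the boxes of the staircase
    [j <= n], reindexed by the last element [j.-1] of their interval, and the
    boxes to its right, which in a row all have the same interval. *)
Lemma big_offdiag_boxes (V : nmodType) n (lam : n.-tuple nat)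
    (F : nat * nat -> V) :
  (\sum_(b <- offdiag_boxes lam) F b =
   \sum_(1 <= i < n) \sum_(i <= j < n) F (i, j.+1) +
   \sum_(1 <= i < n.+1) \sum_(0 <= t < part lam i) F (i, n.+1 + t)%N)%R.
Proof.
rewrite big_allpairs_dep /=.
have -> : (\sum_(1 <= i < n) \sum_(i <= j < n) F (i, j.+1) =
   \sum_(1 <= i < n.+1) \sum_(i <= j < n) F (i, j.+1))%R.
  case: n lam F => [|n] _ F; first by rewrite !big_geq.
  by rewrite [RHS]big_nat_recr //= [X in _ = (_ + X)%R]big_geq // addr0.
rewrite -big_split /=; apply: eq_big_nat => i iP.
rewrite (big_cat_nat _ (n := n.+1)) /=; [|lia|lia].
rewrite -{1}[i.+1]addn1 -[n.+1]addn1 big_addn addnK.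
under eq_bigr do rewrite addn1.
congr (_ + _)%R.
rewrite -{1}[(n + 1)%N]add0n big_addn.
rewrite (_ : ((n + part lam i).+1 - (n + 1) = part lam i)%N); last lia.
by apply: eq_bigr => t _; rewrite [in LHS]addnC.
Qed.

Lemma size_boxes n (lam : n.-tuple nat) :
  size (diag_boxes n ++ offdiag_boxes lam) = diagram_size lam.
Proof.
rewrite size_cat size_map size_iota subn1 /= /diagram_size.
rewrite -(sum1_size (offdiag_boxes lam)) (big_offdiag_boxes lam (fun=> 1%N)) /=.
rewrite addnA; congr (_ + _)%N; last first.
  by apply: eq_bigr => i _; rewrite sum_nat_const_nat subn0 muln1.
rewrite binS bin1 addnC; congr (_ + _)%N.
rewrite -bin2_sum big_nat_rev /=.
case: n lam => [|n] _; first by rewrite !big_geq.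
rewrite [RHS]big_nat_recl //= add0n big_add1; apply: eq_big_nat => i iP.
by rewrite sum_nat_const_nat; lia.
Qed.

(** * From tableaux to gap labellings *)

Lemma ltn_chain (h : nat -> nat) a b : (a < b)%N ->
  (forall j, (a <= j < b)%N -> (h j < h j.+1)%N) -> (h a < h b)%N.
Proof.
elim: b => // b IHb ab hh.
have hb : (h b < h b.+1)%N by apply: hh; lia.
have [lab|ba] := ltnP a b; last by have -> : a = b by lia.
by apply: ltn_trans hb; apply: IHb => // j jP; apply: hh; lia.
Qed.

Lemma count_tableau_leq n (lam : n.-tuple nat) T m :
  set_bij (shifted_diagram lam)
    [set m : nat | (1 <= m <= diagram_size lam)%N]%classic T ->
  (m <= diagram_size lam)%N ->
  count (fun b => T b <= m)%N (diag_boxes n ++ offdiag_boxes lam) = m.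
Proof.
move=> [Tfun Tinj Tsurj] mN.
set s := _ ++ _.
have /permP/(_ (fun y => y <= m)%N) :
    perm_eq [seq T b | b <- s] (iota 1 (diagram_size lam)).
  apply: uniq_perm; rewrite ?iota_uniq //.
    rewrite map_inj_in_uniq ?uniq_boxes // => b c bs cs.
    by apply: Tinj; rewrite inE; apply/shifted_diagramE.
  move=> y; rewrite mem_iota; apply/mapP/idP => [[b bs ->]|yN].
    by have := Tfun b; rewrite /= => /(_ _)/andP[]; [apply/shifted_diagramE | lia].
  have [|b /shifted_diagramE bs <-] := Tsurj y; first by rewrite /=; lia.
  by exists b.
rewrite count_map => ->; rewrite -size_filter.
case: m mN => [|m] mN; last by rewrite (filter_iota_leq 1) ?size_iota.
rewrite (eq_in_filter (a2 := pred0)) ?filter_pred0 // => y.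
by rewrite mem_iota => /andP[? _] /=; lia.
Qed.

Lemma tableau_diag_lt n (lam : n.-tuple nat) T i j :
  standard_tableau lam T -> (1 <= i)%N -> (i < j)%N -> (j <= n)%N ->
  (T (i, i) < T (j, j))%N.
Proof.
move=> [_ Trow Tcol] i1 ij jn.
apply: (ltn_chain (h := fun k => T (k, k)) ij) => k kP.
apply: (@ltn_trans (T (k, k.+1))).
  by apply: Trow; rewrite /shifted_diagram /=; lia.
by apply: Tcol; rewrite /shifted_diagram /=; lia.
Qed.

Lemma tableau_row_lt n (lam : n.-tuple nat) T b :
  standard_tableau lam T -> b \in offdiag_boxes lam ->
  (T (b.1, b.1) < T b)%N.
Proof.
case: b => i j [_ Trow Tcol]; rewrite mem_offdiag_boxes /= => bP.
apply: (ltn_chain (h := fun k => T (i, k))) => [|k kP]; first by lia.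
by apply: Trow; rewrite /shifted_diagram /=; lia.
Qed.

Lemma tableau_col_lt n (lam : n.-tuple nat) T b :
  standard_tableau lam T -> b \in offdiag_boxes lam -> (b.2 <= n)%N ->
  (T b < T (b.2, b.2))%N.
Proof.
case: b => i j [_ Trow Tcol]; rewrite mem_offdiag_boxes /= => bP jn.
apply: (ltn_chain (h := fun k => T (k, j))) => [|k kP]; first by lia.
by apply: Tcol; rewrite /shifted_diagram /=; lia.
Qed.

Lemma count_leqS (T : Type) (h : T -> nat) k (s : seq T) :
  (count (fun b => h b <= k.+1) s =
   count (fun b => h b <= k) s + count (fun b => h b == k.+1) s)%N.
Proof. by elim: s => //= b s ->; lia. Qed.

Lemma content_prefix n (lam : n.-tuple nat) f k :
  gap_labelling lam f -> (k <= n)%N ->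
  (\sum_(m < n | (m < k)%N) content lam f ord0 m =
   count (fun b => f b <= k)%N (offdiag_boxes lam))%N.
Proof.
move=> flab kn.
have -> : (\sum_(m < n | (m < k)%N) content lam f ord0 m =
    \sum_(m < k) count (fun b => f b == m.+1) (offdiag_boxes lam))%N.
  rewrite (big_ord_widen n
    (fun m => count (fun b => f b == m.+1) (offdiag_boxes lam))) //.
  by apply: eq_bigr => m _; rewrite mxE.
elim: k {kn} => [|k IHk].
  rewrite big_ord0; apply/esym/eqP; rewrite eqn0Ngt -has_count; apply/hasPn => b bs.
  by have := flab b bs; rewrite mem_offdiag_boxes in bs; lia.
by rewrite big_ord_recr /= IHk count_leqS.
Qed.

(** Any labelling that agrees with the gaps cut out by the diagonal of [T]
    determines the diagonal: count the boxes of value at most [T (k, k)]. *)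
Lemma diag_vector_labelling n (lam : n.-tuple nat) T f :
  standard_tableau lam T -> gap_labelling lam f ->
  (forall (b : nat * nat) k, b \in offdiag_boxes lam -> (1 <= k <= n)%N ->
     (T b < T (k, k))%N = (f b < k)%N) ->
  diag_vector n T = diag_of_content (content lam f).
Proof.
move=> stT flab fT; apply/rowP => k; rewrite !mxE content_prefix //; last exact: ltnW.
have kdiag : shifted_diagram lam (k.+1, k.+1).
  by rewrite /shifted_diagram /=; have := ltn_ord k; lia.
have [[Tfun Tinj Tsurj] _ _] := stT.
have Tk_le : (T (k.+1, k.+1) <= diagram_size lam)%N.
  by have := Tfun _ kdiag; rewrite /=; lia.
rewrite -{1}(count_tableau_leq (And3 Tfun Tinj Tsurj) Tk_le) count_cat; congr (_ + _)%N.
  rewrite count_map (eq_in_count (a2 := fun i => i <= k.+1)%N) => [|i]; last first.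
    rewrite mem_index_iota => iP /=; have kn := ltn_ord k.
    case: (ltngtP i k.+1) => [ik|ki|->]; last by rewrite leqnn.
      by apply/ltnW/(tableau_diag_lt stT); lia.
    by apply/negbTE; rewrite -ltnNge; apply: (tableau_diag_lt stT); lia.
  by rewrite -[LHS]size_filter /index_iota subn1 (filter_iota_leq 1) ?size_iota.
apply: eq_in_count => b bs; rewrite -[RHS]ltnS -fT //; last by have := ltn_ord k; lia.
rewrite leq_eqVlt; case: eqP => //= eqT.
have bk : b = (k.+1, k.+1).
  apply: Tinj => //; rewrite inE //; apply/shifted_diagramE.
  by rewrite mem_cat bs orbT.
by rewrite bk mem_offdiag_boxes ltnn /= andbF in bs.
Qed.

Lemma diag_vector_gap_content n (lam : n.-tuple nat) T :
  standard_tableau lam T ->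
  exists2 f, gap_labelling lam f &
    diag_vector n T = diag_of_content (content lam f).
Proof.
move=> stT.
(* The gap of [b] is the number of diagonal entries below [T b]. *)
pose f b := count (fun m => T (m, m) < T b)%N (iota 1 n).
have fT (b : nat * nat) k : b \in offdiag_boxes lam -> (1 <= k <= n)%N ->
     (T b < T (k, k))%N = (f b < k)%N.
  move=> bs kP; have [Tbk|Tkb] := ltnP (T b) (T (k, k)); apply/esym.
    rewrite /f (_ : n = k.-1 + (n - k.-1))%N; last by lia.
    rewrite iotaD count_cat [X in (_ + X)%N](_ : _ = 0%N).
      by rewrite addn0 (leq_ltn_trans (count_size _ _)) // size_iota; lia.
    apply/eqP; rewrite eqn0Ngt -has_count; apply/hasPn => m.
    rewrite mem_iota => mP; rewrite -leqNgt; apply: leq_trans (ltnW Tbk) _.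
    case: (eqVneq m k) => [-> //|mk].
    by apply/ltnW/(tableau_diag_lt stT); lia.
  have {}Tkb : (T (k, k) < T b)%N.
    rewrite ltn_neqAle Tkb andbT; apply/eqP => eqT.
    have [[_ Tinj _] _ _] := stT.
    have bk : b = (k, k).
      apply/esym/Tinj => //; rewrite inE //; apply/shifted_diagramE.
        by rewrite mem_cat mem_diag_boxes /= kP eqxx.
      by rewrite mem_cat bs orbT.
    by rewrite bk mem_offdiag_boxes ltnn /= andbF in bs.
  apply/negbTE; rewrite -leqNgt /f (_ : n = k + (n - k))%N; last by lia.
  rewrite iotaD count_cat (_ : count _ (iota 1 k) = k) ?leq_addr //.
  apply/eqP; rewrite -[X in _ == X](size_iota 1) -all_count; apply/allP => m.
  rewrite mem_iota => mP; apply: leq_ltn_trans Tkb.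
  case: (eqVneq m k) => [-> //|mk].
  by apply/ltnW/(tableau_diag_lt stT); lia.
have flab : gap_labelling lam f; last by exists f; last exact: diag_vector_labelling.
move=> b bs.
have lo := tableau_row_lt stT bs.
have bP := bs; rewrite mem_offdiag_boxes in bP.
have f_le : (f b <= n)%N by rewrite /f (leq_trans (count_size _ _)) // size_iota; lia.
have f_ge : (b.1 <= f b)%N.
  by rewrite leqNgt -(fT _ _ bs) ?(andP bP).1 // -leqNgt ltnW.
have [b2n|nb2] := leqP b.2 n; last by rewrite f_ge /= leq_min f_le; lia.
have lt_b2 : (f b < b.2)%N by rewrite -(fT _ _ bs) ?(tableau_col_lt stT) //; lia.
by rewrite f_ge /= leq_min f_le; lia.
Qed.

(** * From gap labellings to tableaux *)

Definition monotone_labelling (n : nat) (lam : n.-tuple nat)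
    (f : nat * nat -> nat) : Prop :=
  forall b c : nat * nat, b \in offdiag_boxes lam -> c \in offdiag_boxes lam ->
    c = (b.1, b.2.+1) \/ c = (b.1.+1, b.2) -> (f b <= f c)%N.

Definition swap_values (f : nat * nat -> nat) (p q b : nat * nat) : nat :=
  f (if b == p then q else if b == q then p else b).

Lemma perm_swap_values (s : seq (nat * nat)) f p q : uniq s ->
  p \in s -> q \in s -> perm_eq (map (swap_values f p q) s) (map f s).
Proof.
move=> us ps qs.
pose sw b := if b == p then q else if b == q then p else b.
have swK : involutive sw.
  rewrite /sw => b; case: (eqVneq b p) => [->|bp]; first by rewrite eqxx; case: eqP.
  by case: (eqVneq b q) => [->|bq]; rewrite ?eqxx // (negPf bp) (negPf bq).
have sw_in b : b \in s -> sw b \in s.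
  by rewrite /sw; case: eqP => // _; case: eqP.
rewrite (map_comp f sw); apply/perm_map/uniq_perm => //.
  by rewrite map_inj_uniq //; apply: inv_inj.
move=> b; apply/mapP/idP => [[c cs ->]|bs]; first exact: sw_in.
by exists (sw b); rewrite ?swK ?sw_in.
Qed.

Lemma content_swap n (lam : n.-tuple nat) f p q :
  p \in offdiag_boxes lam -> q \in offdiag_boxes lam ->
  content lam (swap_values f p q) = content lam f.
Proof.
move=> ps qs; apply/rowP => k; rewrite !mxE.
rewrite -[LHS](count_map (swap_values f p q) (pred1 k.+1)).
rewrite -[RHS](count_map f (pred1 k.+1)).
exact: (permP (perm_swap_values f (uniq_offdiag_boxes lam) ps qs)).
Qed.

(** Among the labellings with a given content, this sum is largest when large
    labels sit far from the corner, which makes it a potential for sorting. *)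
Definition level_moment (n : nat) (lam : n.-tuple nat)
    (f : nat * nat -> nat) : nat :=
  \sum_(b <- offdiag_boxes lam) f b * (b.1 + b.2).

Lemma level_moment_swap n (lam : n.-tuple nat) f (p q : nat * nat) :
  p \in offdiag_boxes lam -> q \in offdiag_boxes lam ->
  (p.1 + p.2 < q.1 + q.2)%N -> (f q < f p)%N ->
  (level_moment lam f < level_moment lam (swap_values f p q))%N.
Proof.
move=> ps qs lt_pq lt_f.
have us := uniq_offdiag_boxes lam.
have qp : q != p by apply: contraTneq lt_pq => ->; rewrite ltnn.
rewrite /level_moment !(bigD1_seq p ps us) /=.
have rem (F : nat * nat -> nat) : (\sum_(b <- offdiag_boxes lam | b != p) F b =
  F q + \sum_(b <- offdiag_boxes lam | (b != p) && (b != q)) F b)%N.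
  rewrite -big_filter (bigD1_seq q) ?filter_uniq ?mem_filter ?qp //=.
  by rewrite big_filter_cond.
rewrite !rem !addnA.
rewrite [X in (_ < _ + X)%N](eq_bigr (fun b => f b * (b.1 + b.2))%N); last first.
  by move=> b /andP[/negPf bp /negPf bq]; rewrite /swap_values bp bq.
by rewrite ltn_add2r /swap_values eqxx (negPf qp) eqxx; nia.
Qed.

(** If [q] is to the south-east of [p], its interval has larger endpoints, so two
    labels that decrease from [p] to [q] both lie in both intervals. *)
Lemma gap_labelling_swap n (lam : n.-tuple nat) f (p q : nat * nat) :
  gap_labelling lam f ->
  p \in offdiag_boxes lam -> q \in offdiag_boxes lam ->
  (p.1 <= q.1)%N -> (p.2 <= q.2)%N -> (f q < f p)%N ->
  gap_labelling lam (swap_values f p q).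
Proof.
move=> flab ps qs le1 le2 lt_f b bs; rewrite /swap_values.
have := flab _ ps; have := flab _ qs; have := flab _ bs.
by case: eqP => [->|_]; [|case: eqP => [->|_]]; lia.
Qed.

(** Exchange decreasing labels of adjacent boxes as long as there are any; the
    level moment increases and is bounded. *)
Lemma monotone_rearrangement n (lam : n.-tuple nat) f :
  gap_labelling lam f ->
  exists g, [/\ gap_labelling lam g, monotone_labelling lam g &
    content lam g = content lam f].
Proof.
have bound g : gap_labelling lam g ->
  (level_moment lam g <= \sum_(b <- offdiag_boxes lam) n * (b.1 + b.2))%N.
  move=> glab; rewrite /level_moment !big_seq leq_sum // => b bs.
  by rewrite leq_mul //; have := glab b bs; lia.
set M := (\sum_(b <- _) _)%N in bound.
have [m] := ubnP (M - level_moment lam f)%N; elim: m f => // m IHm f ltM flab.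
have [mono|] := pselect (monotone_labelling lam f); first by exists f.
move=> /existsNP[p /existsNP[q /not_implyP[ps /not_implyP[qs /not_implyP[pq]]]]].
move=> /negP; rewrite -ltnNge => lt_f.
have le1 : (p.1 <= q.1)%N by case: pq => -> /=.
have le2 : (p.2 <= q.2)%N by case: pq => -> /=.
have lt12 : (p.1 + p.2 < q.1 + q.2)%N by case: pq => -> /=; lia.
have slab := gap_labelling_swap flab ps qs le1 le2 lt_f.
have [|g [glab gmono geq]] := IHm (swap_values f p q) _ slab.
  by have := level_moment_swap ps qs lt12 lt_f; have := bound _ slab; lia.
by exists g; split=> //; rewrite geq content_swap.
Qed.

Lemma index_sort_lt (T : eqType) (key : T -> nat) (s : seq T) x y :
  x \in s -> y \in s -> (key x < key y)%N ->
  (index x (sort (relpre key leq) s) < index y (sort (relpre key leq) s))%N.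
Proof.
move=> xs ys; rewrite ltnNge; apply: contraR; rewrite -leqNgt leq_eqVlt.
move=> /orP[/eqP eq_i|lt_i].
  have /(congr1 (nth x (sort (relpre key leq) s))) := eq_i.
  by rewrite !nth_index ?mem_sort // => ->.
have tr : transitive (relpre key leq) by move=> a b c; apply: leq_trans.
have tot : total (relpre key leq) by move=> a b; apply: leq_total.
by apply: (sorted_ltn_index tr (sort_sorted tot s)); rewrite ?mem_sort.
Qed.

(** Doubling makes room for the diagonal box [(k, k)] just before all the boxes of
    gap [k]. *)
Definition reading_level (f : nat * nat -> nat) (b : nat * nat) : nat :=
  if b.1 == b.2 then b.1.*2 else (f b).*2.+1.

(** Lexicographic order on the level and on [b.1 + b.2], encoded in one number;
    the factor exceeds every [b.1 + b.2].  Comparable boxes of the diagram differ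
    in [b.1 + b.2], hence have different keys. *)
Definition reading_key (n : nat) (lam : n.-tuple nat) f (b : nat * nat) : nat :=
  reading_level f b *
    (\sum_(c <- diag_boxes n ++ offdiag_boxes lam) (c.1 + c.2)).+1 + (b.1 + b.2).

Lemma reading_key_lt n (lam : n.-tuple nat) f (b c : nat * nat) :
  b \in diag_boxes n ++ offdiag_boxes lam ->
  (reading_level f b < reading_level f c)%N ||
    (reading_level f b <= reading_level f c)%N && (b.1 + b.2 < c.1 + c.2)%N ->
  (reading_key lam f b < reading_key lam f c)%N.
Proof.
move=> bs; rewrite /reading_key.
have : (b.1 + b.2 <= \sum_(c <- diag_boxes n ++ offdiag_boxes lam) (c.1 + c.2))%N.
  by rewrite (bigD1_seq b) ?uniq_boxes //= leq_addr.
set S := (\sum_(c <- _) _)%N; move: (reading_level f b) (reading_level f c) => x y; nia.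
Qed.

Definition reading_tableau (n : nat) (lam : n.-tuple nat) f (b : nat * nat) : nat :=
  (index b (sort (relpre (reading_key lam f) leq)
     (diag_boxes n ++ offdiag_boxes lam))).+1.

Lemma reading_tableau_bij n (lam : n.-tuple nat) f :
  set_bij (shifted_diagram lam)
    [set m : nat | (1 <= m <= diagram_size lam)%N]%classic
    (reading_tableau lam f).
Proof.
rewrite /reading_tableau; set s := sort _ _.
have memE b : shifted_diagram lam b <-> b \in s.
  by rewrite mem_sort; apply: shifted_diagramE.
have us : uniq s by rewrite sort_uniq uniq_boxes.
have sz : size s = diagram_size lam by rewrite size_sort size_boxes.
split=> [b /memE bs|b c|m] /=.
- by rewrite -sz index_mem.
- rewrite !inE => /memE bs /memE cs [eq_i].
  by rewrite -(nth_index b bs) eq_i nth_index.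
- move=> mP; have ms : (m.-1 < size s)%N by lia.
  exists (nth (0, 0)%N s m.-1); first by apply/memE/mem_nth.
  by rewrite index_uniq //; lia.
Qed.

Lemma reading_tableau_lt n (lam : n.-tuple nat) f (b c : nat * nat) :
  b \in diag_boxes n ++ offdiag_boxes lam ->
  c \in diag_boxes n ++ offdiag_boxes lam ->
  (reading_level f b < reading_level f c)%N ||
    (reading_level f b <= reading_level f c)%N && (b.1 + b.2 < c.1 + c.2)%N ->
  (reading_tableau lam f b < reading_tableau lam f c)%N.
Proof.
by move=> bs cs lt_bc; rewrite ltnS; apply/index_sort_lt/reading_key_lt.
Qed.

Lemma reading_tableau_standard n (lam : n.-tuple nat) f :
  gap_labelling lam f -> monotone_labelling lam f ->
  standard_tableau lam (reading_tableau lam f).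
Proof.
move=> flab fmono; split; first exact: reading_tableau_bij.
- move=> i j bD cD; have [iP jP] := cD; rewrite /= in iP jP.
  have bs := (shifted_diagramE _ _).1 bD; have cs := (shifted_diagramE _ _).1 cD.
  apply: reading_tableau_lt => //; rewrite /reading_level /=.
  have ij : (i <= j)%N by move: bD => [] /=; lia.
  have iSj : (i == j.+1) = false by lia.
  move: bs cs; rewrite !mem_cat !mem_diag_boxes /= iSj andbF /= => bs cs.
  have /= fc := flab _ cs.
  case: (eqVneq i j) bs => [_ _|_]; first by lia.
  rewrite andbF /= => bs.
  have := fmono _ _ bs cs (or_introl erefl); lia.
- move=> i j bD cD; have [iP jP] := cD; rewrite /= in iP jP.
  have bs := (shifted_diagramE _ _).1 bD; have cs := (shifted_diagramE _ _).1 cD.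
  apply: reading_tableau_lt => //; rewrite /reading_level /=.
  have ij : (i == j) = false by lia.
  move: bs cs; rewrite !mem_cat !mem_diag_boxes /= ij andbF /= => bs cs.
  have /= fb := flab _ bs.
  case: (eqVneq i.+1 j) cs => [Sij _|_]; first by lia.
  rewrite andbF /= => cs.
  have := fmono _ _ bs cs (or_intror erefl); lia.
Qed.

Lemma gap_content_diag_vector n (lam : n.-tuple nat) f :
  gap_labelling lam f ->
  exists2 T, standard_tableau lam T &
    diag_vector n T = diag_of_content (content lam f).
Proof.
move=> /monotone_rearrangement[g [glab gmono <-]].
have stT := reading_tableau_standard glab gmono.
exists (reading_tableau lam g) => //; apply: diag_vector_labelling => // b k bs kP.
have bin : b \in diag_boxes n ++ offdiag_boxes lam by rewrite mem_cat bs orbT.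
have kin : (k, k) \in diag_boxes n ++ offdiag_boxes lam.
  by rewrite mem_cat mem_diag_boxes /= kP eqxx.
have bne : (b.1 == b.2) = false by move: bs; rewrite mem_offdiag_boxes; lia.
have [gk|kg] := ltnP (g b) k.
  by apply: reading_tableau_lt => //; rewrite /reading_level bne eqxx /=; lia.
apply/negbTE; rewrite -leqNgt ltnW //.
by apply: reading_tableau_lt => //; rewrite /reading_level bne eqxx /=; lia.
Qed.

Local Open Scope classical_set_scope.
Local Open Scope card_scope.

(** * Simplices and Minkowski sums *)

Lemma minkowski_big_mem (R : realType) n (I : eqType) (s : seq I)
    (A : I -> set 'rV[R]_n) (w : I -> 'rV[R]_n) :
  (forall i, i \in s -> A i (w i)) ->
  (\big[@minkowski R n/[set 0%R]]_(i <- s) A i) (\sum_(i <- s) w i)%R.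
Proof.
elim: s => [_|i s IHs wA]; first by rewrite !big_nil.
rewrite !big_cons; exists (w i); first by apply: wA; rewrite mem_head.
exists (\sum_(j <- s) w j)%R => //.
by apply: IHs => j js; apply: wA; rewrite inE js orbT.
Qed.

Lemma minkowski_big_decomp (R : realType) n (I : eqType) (s : seq I)
    (A : I -> set 'rV[R]_n) x :
  uniq s -> (\big[@minkowski R n/[set 0%R]]_(i <- s) A i) x ->
  exists2 w : I -> 'rV[R]_n, (forall i, i \in s -> A i (w i)) &
    x = (\sum_(i <- s) w i)%R.
Proof.
elim: s x => [x _|i s IHs x /= /andP[i_s us]].
  by rewrite big_nil => ->; exists (fun=> 0%R) => //; rewrite big_nil.
rewrite big_cons => -[y yA [z zA <-]].
have [w wA ->] := IHs z us zA.
exists (fun j => if j == i then y else w j) => [j|].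
  by rewrite inE; case: eqP => [-> //|_ /=]; apply: wA.
rewrite big_cons eqxx; congr (_ + _)%R; apply: eq_big_seq => j js.
by case: eqP js => [->|//]; rewrite (negPf i_s).
Qed.

Lemma convex_setP (R : realType) (M : lmodType R) (A : set M) :
  @convex_set R M A <->
  (forall x y (t : R), (0 <= t <= 1)%R -> A x -> A y ->
     A (t *: x + (1 - t) *: y)%R).
Proof.
split=> [cA x y t /andP[t0 t1] xA yA|cA x y t xA yA].
  have := cA x y (Itv01 t0 t1) (mem_set xA) (mem_set yA).
  by move/set_mem.
apply/mem_set/cA; [|exact: set_mem|exact: set_mem].
by apply/andP; split.
Qed.

Lemma convex_conv_hull (R : realType) n (A : set 'rV[R]_n) :
  @convex_set R 'rV[R]_n (conv_hull A).
Proof.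
apply/convex_setP => x y t t01 xA yA B [cB AB].
by apply: (convex_setP _).1 => //; [apply: xA|apply: yA].
Qed.

Lemma simplex_vertex (R : realType) n i j m :
  (1 <= m <= n)%N -> (i <= m <= j)%N ->
  simplex R (index_itv n i j) (\row_k (m == k.+1)%:R)%R.
Proof.
move=> mP mij; have mn : (m.-1 < n)%N by lia.
apply: sub_gen_smallest; exists (Ordinal mn); first by rewrite /index_itv /=; lia.
apply/rowP => k; rewrite !mxE /= -(inj_eq val_inj) /=.
by congr (_%:R)%R; lia.
Qed.

Lemma simplex_coords (R : realType) n (I : set 'I_n) (x : 'rV[R]_n) :
  simplex R I x ->
  [/\ (forall k, 0 <= x ord0 k)%R, (\sum_k x ord0 k = 1)%R &
      forall k, x ord0 k != 0%R -> I k].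
Proof.
move: x; rewrite -/(_ `<=` [set x : 'rV[R]_n | [/\ (forall k, 0 <= x ord0 k)%R,
  (\sum_k x ord0 k = 1)%R & forall k, x ord0 k != 0%R -> I k]]).
apply: smallest_sub; last first.
  move=> _ [k Ik <-]; split=> [l||l].
  - by rewrite mxE ler0n.
  - rewrite (bigD1 k) //= big1 ?addr0 ?mxE ?eqxx // => l lk.
    by rewrite mxE (negPf lk) andbF.
  - by rewrite mxE eqxx /=; case: (eqVneq l k) => [-> //|]; rewrite eqxx.
apply/convex_setP => y z t /andP[t0 t1] [y0 y1 yI] [z0 z1 zI]; split=> [k||k].
- by rewrite !mxE addr_ge0 ?mulr_ge0 ?subr_ge0.
- under eq_bigr do rewrite !mxE.
  by rewrite big_split -!mulr_sumr /= y1 z1 !mulr1 addrC subrK.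
- rewrite !mxE; have [yk|/yI //] := eqVneq (y ord0 k) 0%R.
  have [zk|/zI //] := eqVneq (z ord0 k) 0%R.
  by rewrite yk zk !mulr0 addr0 eqxx.
Qed.

(** By induction: [m *: y + v m] is [m.+1] times the average of [y] and [v m] with
    weights [m] and [1]. *)
Lemma dilate_sum (R : realType) n (A : set 'rV[R]_n) (v : nat -> 'rV[R]_n) m :
  @convex_set R 'rV[R]_n A -> A !=set0 ->
  (forall t, (t < m)%N -> A (v t)) ->
  dilate m%:R%R A (\sum_(0 <= t < m) v t)%R.
Proof.
move=> /convex_setP cA [a aA]; elim: m => [_|m IHm vA].
  by exists a => //; rewrite big_geq // scale0r.
have [|y yA sumE] := IHm; first by move=> t tm; apply/vA/ltnW.
have m1 : (m.+1%:R != 0 :> R)%R by rewrite pnatr_eq0.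
exists ((m%:R / m.+1%:R) *: y + (1 - m%:R / m.+1%:R) *: v m)%R.
  apply: cA => //; last exact: vA.
  by rewrite divr_ge0 ?ler0n //= ler_pdivrMr ?ltr0n // mul1r ler_nat.
have mK : (m.+1%:R * (m%:R / m.+1%:R) = m%:R :> R)%R by rewrite mulrCA divff ?mulr1.
rewrite big_nat_recr //= -sumE scalerDr !scalerA mulrBr mulr1 mK.
by rewrite -natrB // subSnn scale1r.
Qed.

(** * Lattice points of the polytope *)

Definition real_row (R : realType) n (c : 'rV[nat]_n) : 'rV[R]_n :=
  map_mx (fun m => m%:R)%R c.

Lemma real_content (R : realType) n (lam : n.-tuple nat) f :
  real_row R (content lam f) =
  (\sum_(b <- offdiag_boxes lam) \row_(k < n) (f b == k.+1)%:R)%R.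
Proof.
apply/rowP => k; rewrite !mxE summxE -sum1_count natr_sum.
rewrite [RHS](bigID (fun b => f b == k.+1)) /=.
rewrite [X in _ = (_ + X)%R]big1 ?addr0 => [|b /negPf bk]; last by rewrite mxE bk.
by apply: eq_bigr => b bk; rewrite mxE bk.
Qed.

Lemma gap_content_polytope (R : realType) n (lam : n.-tuple nat) f :
  gap_labelling lam f -> P_polytope R lam (real_row R (content lam f)).
Proof.
move=> flab.
have box i j : (1 <= i <= n)%N -> (i < j <= n + part lam i)%N ->
    (i <= f (i, j) <= minn j.-1 n)%N.
  by move=> iP jP; apply: (flab (i, j)); rewrite mem_offdiag_boxes iP.
rewrite real_content big_offdiag_boxes.
have add (A B : set 'rV[R]_n) x y : A x -> B y -> minkowski A B (x + y)%R.
  by move=> xA yB; exists x => //; exists y.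
apply: add; apply: minkowski_big_mem => i; rewrite mem_index_iota => iP.
  apply: minkowski_big_mem => j; rewrite mem_index_iota => jP.
  by apply: simplex_vertex; have := box i j.+1; lia.
apply: dilate_sum => [||t tP]; first exact: convex_conv_hull.
  by exists (\row_k (i == k.+1)%:R)%R; apply: simplex_vertex; lia.
by apply: simplex_vertex; have := box i (n.+1 + t)%N; lia.
Qed.

(** Each off-diagonal box receives a weight vector in its simplex, the boxes of a
    row outside the staircase sharing one vector since their simplices are summed
    into a dilate; then [integral_transport_seq] rounds the weights to vertices. *)
Lemma polytope_gap_content (R : realType) n (lam : n.-tuple nat) (x : 'rV[R]_n) :
  (1 <= n)%N -> lattice_points (P_polytope R lam) x ->
  exists2 f, gap_labelling lam f & x = real_row R (content lam f).
Proof.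
move=> n_gt0 [[y yA [z zA xE]] x_int].
have [yy yyA yE] := minkowski_big_decomp (iota_uniq _ _) yA.
have [zz zzA zE] := minkowski_big_decomp (iota_uniq _ _) zA.
have /choice[u uP] i : exists u : nat -> 'rV[R]_n, (1 <= i < n)%N ->
    (forall j, (i <= j < n)%N -> simplex R (index_itv n i j) (u j)) /\
    yy i = (\sum_(i <= j < n) u j)%R.
  have [iP|iP] := boolP (1 <= i < n)%N; last by exists (fun=> 0%R).
  have := yyA i; rewrite mem_index_iota => /(_ iP) yyi.
  have [u uA uE] := minkowski_big_decomp (iota_uniq _ _) yyi.
  by exists u => _; split=> // j jP; apply: uA; rewrite mem_index_iota.
have /choice[v vP] i : exists v : 'rV[R]_n, (1 <= i < n.+1)%N ->
    simplex R (index_itv n i n) v /\ zz i = ((part lam i)%:R *: v)%R.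
  have [iP|iP] := boolP (1 <= i < n.+1)%N; last by exists 0%R.
  have := zzA i; rewrite mem_index_iota => /(_ iP) [v vA vE].
  by exists v => _.
pose w (b : nat * nat) := if (b.2 <= n)%N then u b.1 b.2.-1 else v b.1.
have wP (b : nat * nat) : b \in offdiag_boxes lam ->
    simplex R (index_itv n b.1 (minn b.2.-1 n)) (w b).
  rewrite mem_offdiag_boxes /w => bP; have [b2n|nb2] := leqP b.2 n.
    have [|uS _] := uP b.1; first by lia.
    by rewrite (_ : minn _ _ = b.2.-1); [apply: uS|]; lia.
  have [|vS _] := vP b.1; first by lia.
  by rewrite (_ : minn _ _ = n); last lia.
have xw : x = (\sum_(b <- offdiag_boxes lam) w b)%R.
  rewrite big_offdiag_boxes -xE yE zE; congr (_ + _)%R; apply: eq_big_nat => i iP.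
    have [_ ->] := uP i iP; apply: eq_big_nat => j jP.
    by rewrite /w /= ifT //; lia.
  have [_ ->] := vP i iP; rewrite /w /=.
  rewrite (eq_bigr (fun=> v i)) => [|t _]; last by rewrite ifF //; lia.
  by rewrite sumr_const_nat subn0 scaler_nat.
have x_nat k : exists m : nat, x ord0 k = m%:R%R.
  apply/natrP; rewrite natrEint x_int /= xw summxE.
  by rewrite big_seq sumr_ge0 // => b /wP/simplex_coords[].
have [c cE] := choice x_nat.
have k0 : 'I_n := Ordinal n_gt0.
have [|||f0 [f0w f0c]] := @integral_transport_seq R _ _ k0 (offdiag_boxes lam)
    (fun b k => w b ord0 k) c (uniq_offdiag_boxes lam).
- by move=> b k /wP/simplex_coords[].
- by move=> b /wP/simplex_coords[].
- by move=> k; rewrite -cE xw summxE.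
exists (fun b => (f0 b).+1) => [b bs|].
  by have [_ _] := simplex_coords (wP b bs); apply; apply: f0w.
by apply/rowP => k; rewrite !mxE cE -f0c.
Qed.

(** * The two bijections *)

(** The diagonal gives the number of boxes of gap at most [k] for [k < n]; for
    [k = n] this is the number of all off-diagonal boxes. *)
Lemma diag_of_content_inj n (lam : n.-tuple nat) :
  {in gap_contents lam &, injective (@diag_of_content n)}.
Proof.
move=> _ _ /set_mem[f flab <-] /set_mem[g glab <-] eq_fg.
have pre k : (k <= n)%N ->
   count (fun b => f b <= k)%N (offdiag_boxes lam) =
   count (fun b => g b <= k)%N (offdiag_boxes lam).
  rewrite leq_eqVlt => /orP[/eqP ->|kn].
    have all_leq h : gap_labelling lam h ->
        count (fun b => h b <= n)%N (offdiag_boxes lam) = size (offdiag_boxes lam).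
      move=> hlab; apply/eqP; rewrite -all_count; apply/allP => b bs.
      by have := hlab b bs; rewrite leq_min => /andP[_ /andP[]].
    by rewrite !all_leq.
  have /rowP/(_ (Ordinal kn)) := eq_fg; rewrite !mxE /=.
  by rewrite !content_prefix ?(ltnW kn) // => /addnI.
apply/rowP => k; rewrite !mxE; have := pre k.+1 (ltn_ord k).
by rewrite !count_leqS (pre k (ltnW (ltn_ord k))) => /addnI.
Qed.

Lemma finite_gap_contents n (lam : n.-tuple nat) : finite_set (gap_contents lam).
Proof.
pose N := size (offdiag_boxes lam).
pose rows : set 'rV[nat]_n := [set map_mx (@nat_of_ord N.+1) c | c in setT].
apply: (@sub_finite_set _ _ rows).
  move=> _ [f _ <-]; exists (map_mx inord (content lam f)) => //.
  by apply/rowP => k; rewrite !mxE inordK // ltnS count_size.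
by apply: finite_image; apply: finite_finset.
Qed.

Lemma diag_vectorsE n (lam : n.-tuple nat) :
  diag_vectors lam = @diag_of_content n @` gap_contents lam.
Proof.
rewrite eqEsubset; split=> [_ [T stT <-]|_ [_ [f flab <-] <-]].
  have [f flab ->] := diag_vector_gap_content stT.
  by exists (content lam f) => //; exists f.
have [T stT <-] := gap_content_diag_vector flab.
by exists T.
Qed.

Lemma lattice_points_polytopeE (R : realType) n (lam : n.-tuple nat) :
  (1 <= n)%N ->
  lattice_points (P_polytope R lam) = @real_row R n @` gap_contents lam.
Proof.
move=> n_gt0; rewrite eqEsubset; split=> [x|_ [_ [f flab <-] <-]].
  move=> /(polytope_gap_content n_gt0)[f flab ->].
  by exists (content lam f) => //; exists f.
split=> [|k]; first exact: gap_content_polytope.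
by rewrite mxE intr_nat.
Qed.

Theorem theorem2 (R : realType) (n : nat) (hn : (1 <= n)%N)
    (lam : n.-tuple nat) (hlam : is_partition lam) :
  finite_set (diag_vectors lam) /\
  diag_vectors lam #= lattice_points (P_polytope R lam).
Proof.
rewrite diag_vectorsE lattice_points_polytopeE //; split.
  exact/finite_image/finite_gap_contents.
apply: card_eq_trans (inj_card_eq (@diag_of_content_inj n lam)) _.
apply/card_esym/inj_card_eq => c d _ _ /rowP eq_cd; apply/rowP => k.
by have /eqP := eq_cd k; rewrite !mxE eqr_nat => /eqP.
Qed.
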